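(* Let $(X,S)$ be a primitive association scheme and let $q$ be a prime power. Set $r=\operatorname{rk}_{\min}(\mathbb{F}_q,S)$. Then $$|X|\le\frac{q^{r}-1}{q-1}$$ whenever $r>1$. If $r=1$, then $|X|<q$ and $(X,S)$ is a thin scheme of prime order.
   Context: An association scheme $(X,S)$ consists of a finite set $X$ and a partition $S$ of $X\times X$ that is closed under transposition of relations, contains the diagonal $\Delta=\{(x,x):x\in X\}$, and such that for all $r,s,t\in S$ the number $c_{r,s}^t=|\{z\in X:(x,z)\in r,(z,y)\in s\}|$ does not depend on the choice of $(x,y)\in t$. The valency of $r\in S$ is $d_r=c_{r,r^*}^{\Delta}$, where $r^*$ is the transpose of $r$. $S^*$ denotes the set of all unions of subsets of $S$. The scheme is primitive if $|X|\ge 2$ and every equivalence relation on $X$ belonging to $S^*$ is either $\Delta$ or $X\times X$. It is thin if $d_r=1$ for all $r\in S$. For a field $F$, the adjacency algebra $FS$ is the $F$-linear span in the matrix algebra $\mathrm{Mat}_X(F)$ of the adjacency matrices $A_s$ ($s\in S$), where $A_s$ is the $\{0,1\}$-matrix with $(A_s)_{x,y}=1$ iff $(x,y)\in s$. $J$ denotes the all-one matrix, and $\operatorname{rk}_{\min}(F,S)=\min_{A\in FS\setminus FJ}\operatorname{rk}(A)$. The order of the scheme is $|X|$. *)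

(* Defs.v *)
From HB Require Import structures.
From mathcomp Require Import all_boot all_order all_algebra.

Set Implicit Arguments.
Unset Strict Implicit.
Unset Printing Implicit Defensive.

Import GRing.Theory.

Section Scheme.

Variable X : finType.
Implicit Types (S : {set {set X * X}}) (r s t E : {set X * X}).

Definition diagonal : {set X * X} := [set p | p.1 == p.2].

Definition transpose_rel r : {set X * X} := [set p | (p.2, p.1) \in r].

Definition common_count r s (p : X * X) : nat :=
  #|[set z | ((p.1, z) \in r) && ((z, p.2) \in s)]|.

(* [partition] includes the requirement that the relations in [S] be nonempty. *)
Definition association_scheme S : Prop :=
  [/\ partition S [set: X * X],
      diagonal \in S,
      forall s, s \in S -> transpose_rel s \in S
    & forall r s t, r \in S -> s \in S -> t \in S ->
        {in t &, forall p p', common_count r s p = common_count r s p'}].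

(* The number c_{r,s}^t, read off an arbitrary pair of [t] (see
   [intersection_numberE]); the default value 0 is used only for empty [t]. *)
Definition intersection_number r s t : nat :=
  if [pick p in t] is Some p then common_count r s p else 0.

Definition valency r : nat :=
  intersection_number r (transpose_rel r) diagonal.

Definition scheme_unions S : {set {set X * X}} :=
  [set cover Q | Q in powerset S].

Definition primitive_scheme S : Prop :=
  2 <= #|X| /\
  forall E, E \in scheme_unions S ->
    equivalence_rel (fun x y : X => (x, y) \in E) ->
    E = diagonal \/ E = [set: X * X].

Definition thin_scheme S : Prop := forall r, r \in S -> valency r = 1.

Lemma intersection_numberE S r s t p :
  association_scheme S -> r \in S -> s \in S -> t \in S -> p \in t ->
  intersection_number r s t = common_count r s p.
Proof.
case=> _ _ _ cst rS sS tS pt; rewrite /intersection_number.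
by case: pickP => [p' p't|/(_ p)]; [apply: (cst r s t) | rewrite pt].
Qed.

End Scheme.

Arguments diagonal X : clear implicits.

Local Open Scope ring_scope.

(* Matrices indexed by [X] are square matrices of size [#|X|], the indices
   being identified with the points of [X] by [enum_val]. *)
Definition adjacency_mx (X : finType) (F : fieldType) (s : {set X * X}) :
    'M[F]_#|X| :=
  \matrix_(i, j) ((enum_val i, enum_val j) \in s)%:R.

Definition adjacency_algebra (X : finType) (F : fieldType)
    (S : {set {set X * X}}) : {vspace 'M[F]_#|X|} :=
  <<[seq adjacency_mx F s | s <- enum S]>>%VS.

Definition all_one_line (X : finType) (F : fieldType) : {vspace 'M[F]_#|X|} :=
  <[const_mx 1]>%VS.

(* A rank is at most [#|X|], so the default value of the minimum matters only
   when FS is contained in FJ; see [rk_min_attained] and [rk_min_le]. *)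
Definition rk_min (X : finType) (F : finFieldType) (S : {set {set X * X}}) :
    nat :=
  \big[minn/#|X|]_(A : 'M[F]_#|X| |
      (A \in adjacency_algebra F S) && (A \notin all_one_line X F)) \rank A.

Lemma rk_min_le (X : finType) (F : finFieldType) (S : {set {set X * X}})
    (A : 'M[F]_#|X|) :
  A \in adjacency_algebra F S -> A \notin all_one_line X F ->
  (rk_min F S <= \rank A)%N.
Proof.
move=> AS AJ; have AP : (A \in adjacency_algebra F S) &&
  (A \notin all_one_line X F) by rewrite AS AJ.
rewrite /rk_min -big_filter; have : A \in [seq B <- index_enum _ |
  (B \in adjacency_algebra F S) && (B \notin all_one_line X F)].
  by rewrite mem_filter AP mem_index_enum.
elim: [seq _ <- _ | _] => // B s IHs; rewrite inE big_cons geq_min.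
by case/predU1P => [<-|/IHs ->]; rewrite ?leqnn ?orbT.
Qed.

Lemma rk_min_attained (X : finType) (F : finFieldType)
    (S : {set {set X * X}}) :
  association_scheme S -> (2 <= #|X|)%N ->
  exists A : 'M[F]_#|X|, [/\ A \in adjacency_algebra F S,
    A \notin all_one_line X F & \rank A = rk_min F S].
Proof.
case=> _ dS _ _ X2.
pose P (A : 'M[F]_#|X|) :=
  (A \in adjacency_algebra F S) && (A \notin all_one_line X F).
have PI : P (adjacency_mx F (diagonal X)).
  apply/andP; split.
    by apply: memv_span; apply: map_f; rewrite mem_enum.
  apply/negP => /vlineP[c /matrixP e].
  pose i0 := Ordinal (ltnW X2); pose i1 := Ordinal X2.
  have := e i0 i0; rewrite !mxE inE /= eqxx mulr1 => c1.
  have := e i0 i1; rewrite !mxE inE /= (inj_eq enum_val_inj) mulr1 -c1.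
  by move/eqP; rewrite eq_sym oner_eq0.
have [A PA minA] := arg_minnP (fun A : 'M[F]_#|X| => \rank A) PI.
have [AS AJ] := andP PA; exists A; split=> //.
apply/eqP; rewrite eqn_leq rk_min_le // andbT /rk_min.
apply: (big_ind (fun m => \rank A <= m)%N) => [|m n Am An|B /minA//].
  exact: rank_leq_row.
by rewrite leq_min Am.
Qed.

(* Main.v *)
Require Import Defs.
From mathcomp Require Import all_boot all_order all_algebra.

(** Let [A] in FS \ FJ have minimal rank.  Each of the relations "rows [x] and
    [y] of [A] are equal" and "rows [x] and [y] of [A] are proportional" is an
    equivalence relation in S*, because the numbers c_{r,s}^t determine the
    pairs of entries that occur in two rows from the relation containing
    [(x, y)].  If only identical points have proportional rows, the rows are
    distinct points of the projective space of the row space of [A], which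
    gives the bound.  Otherwise [A] has rank 1, its rows are pairwise distinct,
    and [A x y] = [c * u x / u y] for an injective [u : X -> F^*].  Then a point
    and a relation determine the second point, so the scheme is thin, and the
    ratios of values of [u] form a subgroup of F^* of order |X| without proper
    nontrivial subgroups. *)

Import GRing.Theory.

(** * Functions constant on the relations of the scheme *)

Section Schemes.
Set Implicit Arguments.
Unset Strict Implicit.
Local Open Scope ring_scope.

Context (X : finType) (S : {set {set X * X}}) (hS : association_scheme S).

(** Any codomain is allowed, so that matrices (values in a field) and relations (values in [bool])
    are treated alike. *)
Definition scheme_invariant T (f : X -> X -> T) : Prop :=
  forall s x y x' y', s \in S -> (x, y) \in s -> (x', y') \in s ->
    f x y = f x' y'.

Lemma pblock_scheme (p : X * X) : pblock S p \in S /\ p \in pblock S p.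
Proof.
have [/and3P[/eqP cS _ _] _ _ _] := hS.
have pS : p \in cover S by rewrite cS inE.
by rewrite pblock_mem // mem_pblock.
Qed.

Lemma scheme_invariant_diag T (f : X -> X -> T) x y :
  scheme_invariant f -> f x x = f y y.
Proof.
by have [_ dS _ _] := hS; move=> inv_f; apply: inv_f dS _ _; rewrite inE.
Qed.

(** The point [z] makes an intersection number positive over [(x, y)], hence also over [(x', y')].
    As [z'] depends only on the relations involved, it serves every invariant [f] at once. *)
Lemma scheme_lift s x y x' y' z :
  s \in S -> (x, y) \in s -> (x', y') \in s ->
  exists z', forall T (f : X -> X -> T), scheme_invariant f ->
    [/\ f x z = f x' z', f y z = f y' z' & f z y = f z' y'].
Proof.
have [_ _ trS cst] := hS; move=> sS xys xys'.
have [rS xzr] := pblock_scheme (x, z); have [tS zyt] := pblock_scheme (z, y).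
have /card_gt0P[z'] : (0 < common_count (pblock S (x, z)) (pblock S (z, y))
    (x', y'))%N.
  rewrite -(cst _ _ _ rS tS sS _ _ xys xys'); apply/card_gt0P.
  by exists z; rewrite inE xzr.
rewrite inE => /andP[/= xzr' zyt']; exists z' => T f inv_f.
split; [exact: inv_f rS _ _ | | exact: inv_f tS _ _].
by apply: inv_f (trS _ tS) _ _; rewrite inE.
Qed.

Lemma scheme_lift_diag x x' z :
  exists z', forall T (f : X -> X -> T), scheme_invariant f ->
    f x z = f x' z' /\ f z x = f z' x'.
Proof.
have [_ dS _ _] := hS.
have [||z' lift_z] := @scheme_lift _ x x x' x' z dS; rewrite ?inE //.
by exists z' => T f /lift_z[].
Qed.

Lemma primitive_dichotomy (e : rel X) :
  primitive_scheme S -> equivalence_rel e -> scheme_invariant e ->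
  (forall x y, e x y = (x == y)) \/ (forall x y, e x y).
Proof.
move=> [_ prim] eqv_e inv_e.
pose E := [set p : X * X | e p.1 p.2].
have E_S : E \in scheme_unions S.
  (* By invariance, [E] contains every relation of [S] that it meets. *)
  apply/imsetP; exists [set s in S | s \subset E].
    by rewrite inE; apply/subsetP => s; rewrite inE => /andP[].
  apply/setP => -[x y]; apply/idP/bigcupP => [xyE | [s]]; last first.
    by rewrite inE => /andP[_ /subsetP]; apply.
  have [sS xys] := pblock_scheme (x, y); exists (pblock S (x, y)) => //.
  rewrite inE sS; apply/subsetP => -[x' y'] xys'.
  by move: xyE; rewrite !inE /= (inv_e _ _ _ _ _ sS xys xys').
have eqv_E : equivalence_rel (fun x y : X => (x, y) \in E).
  by move=> x y z; rewrite !inE /=; apply: eqv_e.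
have eE x y : e x y = ((x, y) \in E) by rewrite inE.
by have [eqE|eqE] := prim E E_S eqv_E; [left|right] => x y; rewrite eE eqE inE.
Qed.

Lemma scheme_invariant_rel (e : rel X) :
  (forall s x y x' y', s \in S -> (x, y) \in s -> (x', y') \in s ->
     e x y -> e x' y') -> scheme_invariant e.
Proof.
by move=> e_imp s x y x' y' sS xys xys'; apply/idP/idP; apply: e_imp sS _ _.
Qed.

(** * Equality and proportionality of rows *)

Section InvariantFunction.
Context (F : finFieldType) (f : X -> X -> F) (inv_f : scheme_invariant f).

Definition equal_rows : rel X := fun x y => [forall z, f x z == f y z].

(** The factor is nonzero to make the relation symmetric even in the presence of zero rows. *)
Definition proportional_rows : rel X :=
  fun x y => [exists c, (c != 0) && [forall z, f x z == c * f y z]].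

Lemma equal_rows_invariant : scheme_invariant equal_rows.
Proof.
apply: scheme_invariant_rel => s x y x' y' sS xys xys' /forallP exy.
apply/forallP => z; have [z' lift_z] := scheme_lift z sS xys' xys.
by have [-> -> _] := lift_z _ _ inv_f.
Qed.

Lemma proportional_rows_invariant : scheme_invariant proportional_rows.
Proof.
apply: scheme_invariant_rel => s x y x' y' sS xys xys'.
case/existsP => c /andP[c0 /forallP exy].
apply/existsP; exists c; rewrite c0; apply/forallP => z.
have [z' lift_z] := scheme_lift z sS xys' xys.
by have [-> -> _] := lift_z _ _ inv_f.
Qed.

Lemma equal_rows_equivalence : equivalence_rel equal_rows.
Proof.
move=> x y z; split=> [|/forallP exy]; first exact/forallP.
by apply: eq_forallb => t; rewrite (eqP (exy t)).
Qed.

Lemma proportional_rows_equivalence : equivalence_rel proportional_rows.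
Proof.
apply/equivalence_relP; split=> [x|x y /existsP[c /andP[c0 /forallP exy]] z].
  apply/existsP; exists 1; rewrite oner_neq0.
  by apply/forallP => z; rewrite mul1r.
apply/existsP/existsP => -[d /andP[d0 /forallP edz]].
  exists (c^-1 * d); rewrite mulf_neq0 ?invr_eq0 //.
  by apply/forallP => t; rewrite -mulrA -(eqP (edz t)) (eqP (exy t)) mulKf.
exists (c * d); rewrite mulf_neq0 //.
by apply/forallP => t; rewrite -mulrA -(eqP (edz t)).
Qed.

Lemma row_nonzero x y x' : f x y != 0 -> exists z, f x' z != 0.
Proof.
have [z lift_y] := scheme_lift_diag x x' y.
by have [-> _] := lift_y _ _ inv_f; exists z.
Qed.

Lemma col_nonzero x y y' : f x y != 0 -> exists z, f z y' != 0.
Proof.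
have [z lift_x] := scheme_lift_diag y y' x.
by have [_ ->] := lift_x _ _ inv_f; exists z.
Qed.

End InvariantFunction.

(** * The group of ratios of an injective function *)

Section Ratios.
Context (F : finFieldType) (u : X -> F) (u_inj : injective u).
Context (u_neq0 : forall x, u x != 0).
Context (inv_u : scheme_invariant (fun x y => u x / u y)).

(** Every base point sees the same set of ratios, which is what makes this set closed under
    products. *)
Lemma ratio_translate x y x' : exists z, u x' / u z = u x / u y.
Proof.
have [z lift_y] := scheme_lift_diag x x' y.
by have [-> _] := lift_y _ _ inv_u; exists z.
Qed.

(** Lagrange's argument: multiplication by the ratio permutes the values of [u], so it preserves
    their nonzero product. *)
Lemma ratio_exp_card x y : (u x / u y) ^+ #|X| = 1.
Proof.
set g := u x / u y.
have /fin_all_exists[h hP] x' : exists z, u x' / u z = g.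
  exact: ratio_translate.
have hE x' : u x' = g * u (h x') by rewrite -(hP x') divfK.
have h_inj : injective h.
  by move=> a b e; apply: u_inj; rewrite hE e -hE.
have prod_neq0 : \prod_a u a != 0 by apply/prodf_neq0.
apply: (mulIf prod_neq0); rewrite mul1r {2}(eq_bigr _ (fun a _ => hE a)).
by rewrite big_split /= prodr_const [in LHS](reindex_inj h_inj).
Qed.

Lemma ratio_exp x y m : exists z, (u x / u y) ^+ m = u x / u z.
Proof.
elim: m => [|m [z zP]]; first by exists x; rewrite divff.
have [w wP] := ratio_translate x y z.
by exists w; rewrite exprS zP -wP mulrC mulrA divfK.
Qed.

(** The ratios with numerator [u x] are [#|X|] distinct roots of a polynomial of degree [m]. *)
Lemma card_le_ratio_exp x m :
  (0 < m)%N -> (forall y, (u x / u y) ^+ m = 1) -> (#|X| <= m)%N.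
Proof.
move=> m0 ux; have := @max_unity_roots _ m [seq u x / u y | y <- enum X] m0.
rewrite size_map -cardE; apply; last first.
  rewrite map_inj_uniq ?enum_uniq // => a b /(mulfI (u_neq0 x)) /invr_inj.
  exact: u_inj.
by apply/allP => _ /mapP[y _ ->]; apply/unity_rootP.
Qed.

Lemma ratio_thin : thin_scheme S.
Proof.
have [/and3P[_ _ S0] dS trS _] := hS; move=> r rS.
have /set0Pn[[x y] xyr] : r != set0 by apply: contraNneq S0 => <-.
have xxD : (x, x) \in diagonal X by rewrite inE.
rewrite /valency (intersection_numberE hS rS (trS _ rS) dS xxD).
(* Over [(x, x)] both conditions on [z] say that [(x, z)] lies in [r]; the ratio [u x / u z] then
   determines [z]. *)
apply/eqP/cards1P; exists y; apply/setP => z; rewrite !inE /= andbb.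
apply/idP/eqP => [xzr | -> //]; apply: u_inj; apply: invr_inj.
by apply: (mulfI (u_neq0 x)); apply: inv_u rS _ _.
Qed.

(* For a prime [p] dividing [|X|], consider the relation [u x ^+ p = u y ^+ p].
   If it is the diagonal, Lagrange's theorem makes all ratios
   [(|X| / p)]-th roots of unity, and there are too few of those; otherwise all
   ratios are [p]-th roots of unity, so [|X| <= p]. *)
Lemma ratio_prime : primitive_scheme S -> prime #|X|.
Proof.
move=> prim; have [X2 _] := prim.
have /card_gt0P[x _] := ltnW X2.
pose p := pdiv #|X|; have pr_p : prime p := pdiv_prime X2.
have p_dvd : (p %| #|X|)%N := pdiv_dvd _.
have eqv_e : equivalence_rel (fun a b => u a ^+ p == u b ^+ p).
  by move=> a b c; split=> [|/eqP->].
have powE a b : (u a ^+ p == u b ^+ p) = ((u a / u b) ^+ p == 1).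
  by rewrite expr_div_n -(inj_eq (mulIf (invr_neq0 (expf_neq0 p (u_neq0 b)))))
    divff // expf_neq0.
have inv_e : scheme_invariant (fun a b => u a ^+ p == u b ^+ p).
  move=> s a b a' b' sS abs abs'.
  by rewrite !powE; congr (_ ^+ p == 1); apply: inv_u sS _ _.
have [e_diag|e_all] := primitive_dichotomy prim eqv_e inv_e; last first.
  have le_p : (#|X| <= p)%N.
    by apply: (@card_le_ratio_exp x) (prime_gt0 pr_p) _ => y; apply/eqP;
      rewrite -powE.
  suff -> : #|X| = p by [].
  by apply/eqP; rewrite eqn_leq le_p dvdn_leq // ltnW.
have m_gt0 : (0 < #|X| %/ p)%N.
  by rewrite divn_gt0 ?prime_gt0 // dvdn_leq // ltnW.
suff le_m : (#|X| <= #|X| %/ p)%N.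
  by have := ltn_Pdiv (prime_gt1 pr_p) (ltnW X2); rewrite ltnNge le_m.
apply: (@card_le_ratio_exp x) m_gt0 _ => y.
have [z zP] := ratio_exp x y (#|X| %/ p).
have : u x ^+ p == u z ^+ p.
  by rewrite powE -zP -exprM divnK // ratio_exp_card.
by rewrite zP e_diag => /eqP <-; rewrite divff.
Qed.

End Ratios.

(** * Consequences for a matrix of the adjacency algebra *)

Section Rank.
Context (F : finFieldType) (A : 'M[F]_#|X|).

Definition mx_fun : X -> X -> F := fun x y => A (enum_rank x) (enum_rank y).

Lemma adjacency_algebra_invariant :
  A \in adjacency_algebra F S -> scheme_invariant mx_fun.
Proof.
have [/and3P[_ tiS _] _ _ _] := hS.
move=> A_S s x y x' y' sS xys xys'; rewrite /mx_fun.
rewrite (coord_span A_S) !summxE; apply: eq_bigr => i _; rewrite !mxE.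
set B := _`_i; have : B \in [seq adjacency_mx F t | t <- enum S].
  by rewrite mem_nth ?size_tuple.
case/mapP=> t; rewrite mem_enum => tS ->; rewrite !mxE !enum_rankK.
(* Distinct relations are disjoint, so an adjacency matrix is constant on [s]. *)
have mem_t p : p \in s -> (p \in t) = (s == t).
  move=> ps; apply/idP/eqP => [pt|<- //].
  by rewrite -(def_pblock tiS sS ps) (def_pblock tiS tS pt).
by rewrite !mem_t.
Qed.

(* A constant diagonal turns equality of all rows into equality of all
   entries. *)
Lemma equal_rows_all_one :
  scheme_invariant mx_fun -> (forall x y, equal_rows mx_fun x y) ->
  A \in all_one_line X F.
Proof.
move=> inv_A eqr; case: (pickP (mem X)) => [x0 _ | X0].
  apply/vlineP; exists (mx_fun x0 x0); apply/matrixP => i j; rewrite !mxE mulr1.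
  rewrite (scheme_invariant_diag x0 (enum_val j) inv_A).
  rewrite -(eqP (forallP (eqr (enum_val i) _) _)).
  by rewrite /mx_fun !enum_valK.
rewrite (_ : A = 0) ?mem0v //; apply/matrixP => i.
by have := X0 (enum_val i).
Qed.

Lemma proportional_rows_rank (x0 : X) :
  (forall x y, proportional_rows mx_fun x y) -> (\rank A <= 1)%N.
Proof.
move=> prop.
have /fin_all_exists[c cP] x : exists c, forall z, mx_fun x z = c * mx_fun x0 z.
  have /existsP[c /andP[_ /forallP cP]] := prop x x0.
  by exists c => z; apply/eqP.
have -> : A = (\col_i c (enum_val i)) *m row (enum_rank x0) A.
  apply/matrixP => i j; rewrite mxE big_ord1 !mxE.
  by have := cP (enum_val i) (enum_val j); rewrite /mx_fun !enum_valK.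
exact: mulmx_max_rank.
Qed.

(** Nonzero multiples of pairwise non-proportional rows are distinct nonzero vectors of the row
    space, so [#|X| * (#|F| - 1)] is at most the number of such vectors. *)
Lemma card_projective_bound :
  (forall x, exists y, mx_fun x y != 0) ->
  (forall x y, proportional_rows mx_fun x y = (x == y)) ->
  (#|X| <= (#|F| ^ \rank A - 1) %/ (#|F| - 1))%N.
Proof.
have F_gt1 : (1 < #|F|)%N := card_finNzRing_gt1 F.
move=> row_neq0 prop; rewrite leq_divRL ?subn_gt0 //.
(* [w x] holds the coordinates of row [x] of [A] in the basis [row_base A]. *)
pose w (x : X) := row (enum_rank x) (col_base A).
have wE x y : (w x *m row_base A) 0 (enum_rank y) = mx_fun x y.
  by rewrite -row_mul mulmx_base mxE.
have w_neq0 x : w x != 0.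
  have [y] := row_neq0 x; apply: contraNneq => w0.
  by rewrite -wE w0 mul0mx mxE.
pose h (xc : X * F) := xc.2 *: w xc.1.
have h_inj : {in setX [set: X] [set~ 0] &, injective h}.
  move=> [x c] [y d]; rewrite !inE /h /= => c0 d0 e.
  have wxy : w x = (c^-1 * d) *: w y by rewrite -scalerA -e scalerK.
  have /eqP exy : x == y.
    rewrite -prop; apply/existsP; exists (c^-1 * d).
    rewrite mulf_neq0 ?invr_eq0 //; apply/forallP => z.
    by rewrite -!wE wxy -scalemxAl mxE.
  move/eqP: e; rewrite exy -subr_eq0 -scalerBl scaler_eq0.
  by rewrite (negPf (w_neq0 y)) orbF subr_eq0 => /eqP ->.
have -> : (#|F| ^ \rank A - 1)%N = #|[set~ (0 : 'rV[F]_(\rank A))]|.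
  by rewrite cardsC1 card_mx mul1n subn1.
have -> : (#|X| * (#|F| - 1))%N = #|setX [set: X] [set~ (0 : F)]|.
  by rewrite cardsX cardsT cardsC1 subn1.
rewrite -(card_in_imset h_inj).
apply/subset_leq_card/subsetP => v /imsetP[[x c]].
by rewrite !inE /= => c0 ->; rewrite scaler_eq0 negb_or c0 w_neq0.
Qed.

(** Write [A] as a column [u] times a row [v]; the constant diagonal [c = u y * v y] turns [v y]
    into [c / u y]. *)
Lemma rank1_ratio :
  scheme_invariant mx_fun -> (exists x y, mx_fun x y != 0) -> \rank A = 1%N ->
  exists c u, [/\ c != 0, forall x, u x != 0
    & forall x y, mx_fun x y = c * (u x / u y)].
Proof.
move=> inv_A [x1 [y1 xy1]] rA.
have [u [v Auv]] : exists (u : 'cV_#|X|) (v : 'rV_#|X|), A = u *m v.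
  move: (col_base A) (row_base A) (mulmx_base A); rewrite rA => u v <-.
  by exists u, v.
pose uX x := u (enum_rank x) 0; pose vX x := v 0 (enum_rank x).
have fE x y : mx_fun x y = uX x * vX y.
  by rewrite /mx_fun Auv mxE big_ord1.
have u_neq0 x : uX x != 0.
  have [z] := row_nonzero inv_A x xy1.
  by apply: contraNneq => u0; rewrite fE u0 mul0r.
have v_neq0 y : vX y != 0.
  have [z] := col_nonzero inv_A y xy1.
  by apply: contraNneq => v0; rewrite fE v0 mulr0.
exists (mx_fun x1 x1), uX; split=> // [|x y]; first by rewrite fE mulf_neq0.
rewrite (scheme_invariant_diag x1 y inv_A) !fE mulrCA.
by rewrite [uX y * _]mulrC mulfK.
Qed.

End Rank.

End Schemes.

(** * The projective bound and the rank-one case, for a matrix of minimal rank *)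

Theorem theorem1p1 (X : finType) (S : {set {set X * X}})
    (q : nat) (F : finFieldType)
    (hS : association_scheme S) (hprim : primitive_scheme S)
    (hq : exists p k : nat, [/\ prime p, 0 < k & q = p ^ k])
    (hF : #|F| = q) :
  let r := rk_min F S in
  (1 < r -> #|X| <= (q ^ r - 1) %/ (q - 1)) /\
  (r = 1 -> [/\ #|X| < q, thin_scheme S & prime #|X|]).
Proof.
move=> r; have [X2 _] := hprim; rewrite /r -hF => {r q hq hF}.
have /card_gt0P[x0 _] := ltnW X2.
have [A [A_S A_J <-]] := rk_min_attained F hS X2.
have inv_A := adjacency_algebra_invariant hS A_S.
have A_neq0 : exists x y, mx_fun A x y != 0%R.
  have /matrix0Pn[i [j Aij]] : A != 0%R.
    by apply: contraNneq A_J => ->; apply: mem0v.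
  by exists (enum_val i), (enum_val j); rewrite /mx_fun !enum_valK.
split=> [rA|rA].
  have [prop|prop] := primitive_dichotomy hS hprim
      (proportional_rows_equivalence _)
      (proportional_rows_invariant hS inv_A).
    apply: card_projective_bound prop => x; have [a [b ab]] := A_neq0.
    exact: (row_nonzero hS inv_A x ab).
  by have := proportional_rows_rank x0 prop; rewrite leqNgt rA.
have [c [u [c0 u0 Au]]] := rank1_ratio hS inv_A A_neq0 rA.
have u_inj : injective u.
  have [eqr|eqr] := primitive_dichotomy hS hprim
      (equal_rows_equivalence _)
      (equal_rows_invariant hS inv_A); last first.
    by case/negP: A_J; apply: (equal_rows_all_one hS inv_A eqr).
  move=> x y uxy; apply/eqP; rewrite -eqr; apply/forallP => z.
  by rewrite !Au uxy.
have inv_u : scheme_invariant S (fun x y => u x / u y)%R.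
  move=> s x y x' y' sS xys xys'; apply: (mulfI c0).
  by rewrite -!Au; apply: inv_A sS _ _.
split; [|exact: (ratio_thin hS u_inj u0 inv_u)|
  exact: (ratio_prime hS u_inj u0 inv_u hprim)].
(* The strict bound holds because the injective [u] misses zero. *)
have /subset_leq_card : [set u x | x : X] \subset [set~ 0%R].
  by apply/subsetP => _ /imsetP[x _ ->]; rewrite !inE.
rewrite card_imset // cardsC1 => /leq_ltn_trans; apply.
by rewrite prednK // ltnW // card_finNzRing_gt1.
Qed.
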